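(* Let $d\in\mathbb N$, $d\ge 1$, and let $(g_\theta)_{\theta\in\mathbb R}$ be a one-parameter (additive) group action on $\mathbb R^d$, i.e. a family of maps $g_\theta:\mathbb R^d\to\mathbb R^d$ such that (1) $g_\theta$ is a bijection for every $\theta\in\mathbb R$; (2) $g_{\theta_1+\theta_2}=g_{\theta_1}\circ g_{\theta_2}$ for all $\theta_1,\theta_2\in\mathbb R$; (3) $g_0$ is the identity mapping on $\mathbb R^d$; (4) $g_{-\theta}=(g_\theta)^{-1}$ for all $\theta\in\mathbb R$. Suppose further that the map $\mathbb R\times\mathbb R^d\to\mathbb R^d$, $(\theta,x)\mapsto g_\theta(x)$, is $\mathcal C^\infty$. Let $f\in\mathcal G(\mathbb R^d)$. Then for each $\theta\in\widetilde{\mathbb R}_c$, the composition $f\circ g_\theta$ is a well-defined element of $\mathcal G(\mathbb R^d)$. Moreover, if $f\circ g_\theta=f$ in $\mathcal G(\mathbb R^d)$ for all $\theta\in\mathbb R$, then $f\circ g_\theta=f$ in $\mathcal G(\mathbb R^d)$ for all $\theta\in\widetilde{\mathbb R}_c$.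
   Context: The special Colombeau algebra: let $\mathcal E(\mathbb R^d)$ be the algebra of all nets $(u_\varepsilon)_{\varepsilon\in(0,1)}$ of $\mathcal C^\infty$-functions $\mathbb R^d\to\mathbb C$. Let $\mathcal E_M(\mathbb R^d)$ be the set of $(u_\varepsilon)_\varepsilon\in\mathcal E(\mathbb R^d)$ such that for every compact $K\subset\mathbb R^d$ and every multi-index $\alpha\in\mathbb N^d$ there exists $b\in\mathbb R$ with $\sup_{x\in K}|\partial^\alpha u_\varepsilon(x)|=O(\varepsilon^b)$ as $\varepsilon\to0$. Let $\mathcal N(\mathbb R^d)$ be the set of those $(u_\varepsilon)_\varepsilon\in\mathcal E(\mathbb R^d)$ such that for every compact $K$, every $\alpha\in\mathbb N^d$ and every $b\in\mathbb R$, $\sup_{x\in K}|\partial^\alpha u_\varepsilon(x)|=O(\varepsilon^b)$ as $\varepsilon\to0$. Then $\mathcal G(\mathbb R^d)=\mathcal E_M(\mathbb R^d)/\mathcal N(\mathbb R^d)$. The ring $\widetilde{\mathbb R}_c$ of Colombeau generalized real numbers with bounded representative consists of the nets $(x_\varepsilon)_{\varepsilon\in(0,1)}$ of real numbers that are bounded for small $\varepsilon$, modulo the nets satisfying $|x_\varepsilon|=O(\varepsilon^b)$ as $\varepsilon\to0$ for every $b\in\mathbb R$. $\mathbb R$ is embedded in $\widetilde{\mathbb R}_c$ by constant nets. For $\theta\in\widetilde{\mathbb R}_c$ with bounded representative $(\theta_\varepsilon)_\varepsilon$, $g_\theta\in\mathcal G(\mathbb R^d)^d$ is the class of $(g_{\theta_\varepsilon})_\varepsilon$,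 and $f\circ g_\theta$ is defined on representatives by $(f\circ g_\theta)_\varepsilon=f_\varepsilon\circ g_{\theta_\varepsilon}$; well-defined means that this net is in $\mathcal E_M(\mathbb R^d)$ and that its class modulo $\mathcal N(\mathbb R^d)$ does not depend on the choice of representatives. *)

(* Defs.v *)
From mathcomp Require Import all_boot all_order all_algebra.
From mathcomp Require Import all_classical all_reals all_analysis.
From mathcomp.real_closed Require Import complex.

Set Implicit Arguments.
Unset Strict Implicit.
Unset Printing Implicit Defensive.

Import Order.TTheory GRing.Theory Num.Theory.
Import numFieldNormedType.Exports.

Local Open Scope classical_set_scope.
Local Open Scope ring_scope.

Section Smooth.
Context {R : realType}.

(* The derivative is quantified over all directions rather than over a basis,
   so that the definition applies as is to R^d and to R x R^d.  The domains
   are meant to be finite-dimensional: there, C^k regularity of x |-> 'd f x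
   is the same as C^k regularity of x |-> 'D_v f x for every v. *)
Fixpoint Ck {V W : normedModType R} (k : nat) (f : V -> W) : Prop :=
  if k is k'.+1
  then (forall x, differentiable f x) /\ (forall v, Ck k' ('D_v f))
  else continuous f.

Definition smooth {V W : normedModType R} (f : V -> W) : Prop :=
  forall k, Ck k f.

Definition partial {d : nat} (alpha : 'I_d -> nat) (f : 'rV[R]_d -> R^o) :
    'rV[R]_d -> R^o :=
  foldr (fun i h => iter (alpha i) (fun k => 'D_(delta_mx 0 i) k) h) f
    (enum 'I_d).

(* R[i] carries no real normed module structure in the libraries, hence the
   componentwise definitions. *)
Definition smoothC {d : nat} (u : 'rV[R]_d -> R[i]) : Prop :=
  smooth (fun x => complex.Re (u x) : R^o) /\
  smooth (fun x => complex.Im (u x) : R^o).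

Definition partialC {d : nat} (alpha : 'I_d -> nat) (u : 'rV[R]_d -> R[i]) :
    'rV[R]_d -> R[i] :=
  fun x => Complex (partial alpha (fun y => complex.Re (u y)) x)
                   (partial alpha (fun y => complex.Im (u y)) x).

End Smooth.

Section Colombeau.
Context {R : realType}.

Definition bigO_rate (b : R) (h : R -> R) : Prop :=
  (h : R -> R^o) =O_ (0^'+) (fun e : R => e `^ b : R^o).

(* Nets are total functions of epsilon whose values outside ]0, 1[ are
   irrelevant: no definition below constrains them, so a class modulo
   negligible nets contains every modification of its members there. *)
Definition net (d : nat) : Type := R -> 'rV[R]_d -> R[i].

Definition EE (d : nat) : set (net d) :=
  [set u | forall e : R, 0 < e < 1 -> smoothC (u e)].

(* For u in EE the set below is bounded, so that sup is the genuine supremum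
   when K is nonempty; sup set0 = 0. *)
Definition seminorm {d : nat} (K : set 'rV[R]_d) (alpha : 'I_d -> nat)
    (u : 'rV[R]_d -> R[i]) : R :=
  sup [set Normc.normc (partialC alpha u x) | x in K].

Definition EM (d : nat) : set (net d) :=
  [set u | EE u /\
     forall (K : set 'rV[R]_d) (alpha : 'I_d -> nat), compact K ->
       exists b : R, bigO_rate b (fun e => seminorm K alpha (u e))].

Definition NN (d : nat) : set (net d) :=
  [set u | EE u /\
     forall (K : set 'rV[R]_d) (alpha : 'I_d -> nat), compact K ->
       forall b : R, bigO_rate b (fun e => seminorm K alpha (u e))].

(* The coset u + NN; the quotient is the set of cosets of elements of EM. *)
Definition gclass {d : nat} (u : net d) : set (net d) :=
  [set v | NN (fun e x => v e x - u e x)].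

Definition GG (d : nat) : set (set (net d)) := [set gclass u | u in @EM d].

Definition bounded_rnet : set (R -> R) :=
  [set t | exists M : R, \forall e \near 0^'+, `|t e| <= M].

Definition negligible_rnet : set (R -> R) :=
  [set t | forall b : R, bigO_rate b (fun e => `|t e|)].

Definition rclass (t : R -> R) : set (R -> R) :=
  [set s | negligible_rnet (fun e => s e - t e)].

Definition Rtilde_c : set (set (R -> R)) := [set rclass t | t in bounded_rnet].

Definition cst_rclass (r : R) : set (R -> R) := rclass (fun=> r).

End Colombeau.

Arguments EE {R d}.
Arguments EM {R d}.
Arguments NN {R d}.
Arguments GG : clear implicits.
Arguments Rtilde_c : clear implicits.

Section Composition.
Context {R : realType} {d : nat} (g : R -> 'rV[R]_d -> 'rV[R]_d).

Definition comp_net (u : @net R d) (t : R -> R) : @net R d :=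
  fun e x => u e (g (t e) x).

Definition comp_well_defined (f : set (@net R d)) (th : set (R -> R)) : Prop :=
  (forall u t, f u -> th t -> EM (comp_net u t)) /\
  (forall u u' t t', f u -> f u' -> th t -> th t' ->
     gclass (comp_net u t) = gclass (comp_net u' t')).

(* The union of the classes obtained from all representatives; by
   comp_well_defined these all coincide, and the union is that class. *)
Definition compG (f : set (@net R d)) (th : set (R -> R)) : set (@net R d) :=
  [set w | exists u t, [/\ f u, th t & gclass (comp_net u t) w]].

End Composition.

(* Main.v *)
Require Import Defs.
From mathcomp Require Import all_boot all_order all_algebra.
From mathcomp Require Import all_classical all_reals all_analysis.
From mathcomp Require Import lra.
From mathcomp.real_closed Require Import complex.

(** The composition is handled on [R x R^d]. For a net [u] of representatives,
    put [F e (th, x) = u e (g th x)]; the flow does not depend on e, so by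
    the chain rule all derivatives of [F e] on a compact set of [R x R^d] are
    bounded by finitely many derivatives of [u e] on a compact set of [R^d]
    ([tame_comp]). A bounded net of parameters stays in a compact interval, and
    freezing [th := t e] therefore turns moderate nets into moderate nets and
    negligible nets into negligible ones ([tame_slice]). If [t] is changed by a
    negligible net, the mean value theorem in [th] bounds the change of each
    derivative of [F e] by a negligible factor times a moderate one
    ([tame_slice_sub]). This is the well-definedness.

    For the second part, invariance under each constant parameter has to be made
    uniform on compact sets of parameters. For a fixed compact set, derivative
    and exponent b, let A_n be the set of the parameters [th] for which the
    derivative of [u e o g th - u e] is at most e^b for all e < 1/(n+1). These
    sets are closed and cover the line, so by Baire's theorem one of them
    contains a ball around some [th0] ([baire_near]). The group law moves this
    ball to any other place: the difference between the parameters [s + th1] and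
    [s] is [(u e o g th1 - u e) o g s], a negligible net composed with the flow,
    hence small uniformly in [s] by the first part. Comparing [s + th1] with
    [s], and [s] with [s + th0], gives the estimate around every [th1], and a
    compactness argument gives it on every bounded interval
    ([uniform_invariance]).

    The seminorms involve derivatives in one fixed order of the coordinates,
    whereas the chain rule produces them in any order; this is reconciled by
    the equality of mixed derivatives ([derive_comm]). Everything is proved for
    real-valued nets and applied to real and imaginary parts. *)

Set Implicit Arguments.
Unset Strict Implicit.
Unset Printing Implicit Defensive.

Import Order.TTheory GRing.Theory Num.Theory.
Import numFieldNormedType.Exports.

Local Open Scope classical_set_scope.
Local Open Scope ring_scope.

(** * Differential calculus of smooth maps *)

Section Calculus.
Context {R : realType}.
Implicit Types V W : normedModType R.

Lemma CkSE V W k (f : V -> W) : Ck k.+1 f =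
  ((forall x, differentiable f x) /\ (forall v, Ck k ('D_v f))).
Proof. by []. Qed.

Lemma CkW V W k (f : V -> W) : Ck k.+1 f -> Ck k f.
Proof.
elim: k f => [|k IHk] f /= [df Df].
  by move=> x; exact/differentiable_continuous/df.
by split=> // v; exact/IHk/Df.
Qed.

Lemma smooth_differentiable V W (f : V -> W) x : smooth f -> differentiable f x.
Proof. by move=> /(_ 1%N)[]. Qed.

Lemma smooth_derivable V W (f : V -> W) x v : smooth f -> derivable f x v.
Proof. by move=> sf; exact/diff_derivable/smooth_differentiable. Qed.

Lemma smooth_continuous V W (f : V -> W) : smooth f -> continuous f.
Proof. by move=> /(_ 0%N). Qed.

Lemma smooth_derive V W (f : V -> W) v : smooth f -> smooth ('D_v f).
Proof. by move=> sf k; exact: (proj2 (sf k.+1)). Qed.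

Lemma Ck_cst V W k (a : W) : Ck k (fun _ : V => a).
Proof.
elim: k a => [|k IHk] a /=; first exact: cst_continuous.
split=> [x|v]; first exact: differentiable_cst.
have -> : 'D_v (fun _ : V => a) = fun=> 0.
  by apply/funext => x; exact: derive_cst.
exact: IHk.
Qed.

Lemma smooth_id V : smooth (@id V).
Proof.
case=> [|k]; first by move=> x; exact: cvg_id.
rewrite CkSE; split=> // v.
have -> : 'D_v (@id V) = fun=> v by apply/funext => x; exact: derive_id.
exact: Ck_cst.
Qed.

Lemma Ck_add V W k (f g : V -> W) :
  Ck k f -> Ck k g -> Ck k (fun x => f x + g x).
Proof.
elim: k f g => [|k IHk] f g /=.
  by move=> cf cg x; apply: cvgD; [exact: cf|exact: cg].
move=> [df Df] [dg Dg]; split=> [x|v].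
  by apply: differentiableD; [exact: df|exact: dg].
rewrite (_ : 'D_v _ = fun x => 'D_v f x + 'D_v g x); first exact: IHk.
by apply/funext => x; apply: deriveD; exact: diff_derivable.
Qed.

Lemma Ck_mul V k (f g : V -> R^o) :
  Ck k f -> Ck k g -> Ck k (fun x => f x * g x : R^o).
Proof.
elim: k f g => [|k IHk] f g.
  by move=> cf cg x; apply: cvgM; [exact: cf|exact: cg].
move=> Cf Cg; move: (Cf) (Cg); rewrite !CkSE => -[df Df] [dg Dg]; split=> [x|v].
  by apply: differentiableM; [exact: df|exact: dg].
rewrite (_ : 'D_v _ = fun x => f x * 'D_v g x + g x * 'D_v f x :> R^o).
  by apply: Ck_add; apply: IHk => //; exact: CkW.
by apply/funext => x; apply: deriveM; exact: diff_derivable.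
Qed.

Lemma Ck_sum V k n (f : 'I_n -> V -> R^o) :
  (forall i, Ck k (f i)) -> Ck k (fun x => \sum_i f i x : R^o).
Proof.
elim: n f => [|n IHn] f Cf.
  rewrite (_ : (fun _ => _) = fun=> 0); first exact: Ck_cst.
  by apply/funext => x; rewrite big_ord0.
rewrite (_ : (fun _ => _) = fun x => f ord0 x + \sum_i f (lift ord0 i) x :> R^o).
  by apply: Ck_add => //; exact: IHn.
by apply/funext => x; rewrite big_ord_recl.
Qed.

Lemma derive_coord V n (F : V -> 'rV[R]_n) j x v : derivable F x v ->
  'D_v (fun y => F y 0 j : R^o) x = 'D_v F x 0 j.
Proof. by move=> dF; rewrite [in RHS]derive_mx// mxE. Qed.

Lemma Ck_coord V n k (F : V -> 'rV[R]_n) j :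
  Ck k F -> Ck k (fun x => F x 0 j : R^o).
Proof.
elim: k F => [|k IHk] F /=.
  move=> cF x; apply: (@continuous_comp _ _ _ F (fun M : 'rV[R]_n => M 0 j : R^o)).
    exact: cF.
  exact: coord_continuous.
move=> [dF DF]; split=> [x|v].
  apply: (@differentiable_comp _ _ _ _ F (fun M : 'rV[R]_n => M 0 j : R^o)) => //.
  exact: differentiable_coord.
rewrite (_ : 'D_v _ = fun x => 'D_v F x 0 j); first exact: IHk.
by apply/funext => x; apply/derive_coord/diff_derivable.
Qed.

(** The chain rule written with the coordinate directions of the intermediate
    space: in this form the right-hand side is built from sums and products
    only, so that inductions on the order of differentiation go through. *)
Lemma derive_row_comp V n (w : 'rV[R]_n -> R^o) (G : V -> 'rV[R]_n) x v :
  differentiable G x -> differentiable w (G x) ->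
  'D_v (w \o G) x = \sum_j 'D_(delta_mx 0 j) w (G x) * 'D_v G x 0 j :> R^o.
Proof.
move=> dG dw; rewrite deriveE; last exact: differentiable_comp.
rewrite diff_comp//= -[X in 'd w (G x) X]deriveE//.
rewrite [X in 'd w (G x) X]row_sum_delta linear_sum.
by apply: eq_bigr => j _; rewrite linearZ/= -deriveE// mulrC.
Qed.

(** The outer function has to be generalized over in the induction: one
    derivative of [w \o G] involves the functions ['D_(delta_mx 0 j) w \o G]. *)
Lemma smooth_comp V n (w : 'rV[R]_n -> R^o) (G : V -> 'rV[R]_n) :
  smooth w -> smooth G -> smooth (w \o G).
Proof.
move=> sw sG k; elim: k w sw => [|k IHk] w sw.
  move=> x; apply: (@continuous_comp _ _ _ G w x).
    exact: (smooth_continuous sG).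
  exact: (smooth_continuous sw).
rewrite CkSE; split=> [x|v].
  by apply: differentiable_comp; exact: smooth_differentiable.
rewrite (_ : 'D_v _ = fun x =>
    \sum_j ('D_(delta_mx 0 j) w \o G) x * 'D_v G x 0 j :> R^o).
  apply: Ck_sum => j; apply: Ck_mul; first exact/IHk/smooth_derive.
  exact/Ck_coord/smooth_derive.
apply/funext => x; apply: derive_row_comp; exact: smooth_differentiable.
Qed.

Lemma smoothD V W (f g : V -> W) :
  smooth f -> smooth g -> smooth (fun x => f x + g x).
Proof. by move=> sf sg k; exact: Ck_add. Qed.

Lemma smoothM V (f g : V -> R^o) :
  smooth f -> smooth g -> smooth (fun x => f x * g x : R^o).
Proof. by move=> sf sg k; exact: Ck_mul. Qed.

Lemma smoothN V (f : V -> R^o) : smooth f -> smooth (fun x => - f x : R^o).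
Proof.
move=> sf; rewrite (_ : (fun _ => _) = fun x => -1 * f x :> R^o).
  by apply: smoothM => // k; exact: Ck_cst.
by apply/funext => x; rewrite mulN1r.
Qed.

Lemma smoothB V (f g : V -> R^o) :
  smooth f -> smooth g -> smooth (fun x => f x - g x : R^o).
Proof. by move=> sf sg; apply: smoothD => //; exact: smoothN. Qed.

(** A directional derivative only sees the function along one line. This relates
    derivatives of functions on different spaces, for instance of a function and
    of its restriction to a line or to a slice. *)
Lemma derive_along_eq V V' W (f : V -> W) (f' : V' -> W) a v a' v' :
  (forall t : R, f (t *: v + a) = f' (t *: v' + a')) ->
  'D_v f a = 'D_v' f' a' /\ derivable f a v = derivable f' a' v'.
Proof.
move=> ff'; rewrite /derive /derivable.
have -> : (fun t : R => t^-1 *: ((f \o shift a) (t *: v) - f a)) =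
          (fun t : R => t^-1 *: ((f' \o shift a') (t *: v') - f' a')).
  apply/funext => t /=; rewrite ff'.
  by have := ff' 0; rewrite !scale0r !add0r => ->.
by [].
Qed.

Lemma MVT_along V (h : V -> R^o) (a v : V) :
  (forall x, differentiable h x) ->
  exists2 c : R, 0 <= c <= 1 & h (a + v) - h a = 'D_v h (a + c *: v).
Proof.
move=> dh; pose phi (s : R) : R := h (a + s *: v).
have dphi (s : R) : is_derive s 1 phi ('D_v h (a + s *: v)).
  have [<- dE] : 'D_1 (phi : R -> R^o) s = 'D_v h (a + s *: v) /\
      derivable (phi : R -> R^o) s 1 = derivable h (a + s *: v) v.
    apply: derive_along_eq => t.
    by rewrite /phi scalerDl addrCA /GRing.scale /= mulr1.
  by apply: derivableP; rewrite dE; exact: diff_derivable.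
have cphi : {within `[0, 1], continuous phi}.
  by apply: derivable_within_continuous => s _; have [] := dphi s.
have [c c01] := MVT ltr01 (fun s _ => dphi s) cphi.
rewrite /phi scale1r scale0r addr0 subr0 mulr1 => ->; exists c => //.
by move: c01; rewrite in_itv/= => /andP[/ltW-> /ltW->].
Qed.

Lemma derive_scale_dir V (h : V -> R^o) (s : R) x v :
  differentiable h x -> 'D_(s *: v) h x = s * 'D_v h x.
Proof. by move=> dh; rewrite !deriveE// linearZ. Qed.

Lemma derive_translate V W (f : V -> W) (a v x : V) :
  'D_v (fun y => f (y + a)) x = 'D_v f (x + a).
Proof. by apply: (proj1 (derive_along_eq _)) => t; rewrite addrA. Qed.

Lemma differentiable_shift V W (f : V -> W) (a x : V) :
  differentiable f (x + a) -> differentiable (fun x => f (x + a)) x.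
Proof.
by move=> df; apply: (@differentiable_comp _ _ _ _ (fun x => x + a) f).
Qed.

Lemma smooth_shift V W (f : V -> W) (a : V) :
  smooth f -> smooth (fun x => f (x + a)).
Proof.
move=> sf k; elim: k f sf => [|k IHk] f sf.
  move=> x; apply: (@continuous_comp _ _ _ (fun x => x + a) f).
    by apply: cvgD; [exact: cvg_id|exact: cvg_cst].
  exact: smooth_continuous.
rewrite CkSE; split=> [x|v]; first exact/differentiable_shift/smooth_differentiable.
have -> : 'D_v (fun y => f (y + a)) = fun y => 'D_v f (y + a).
  by apply/funext => x; exact: derive_translate.
exact: (IHk _ (smooth_derive v sf)).
Qed.

(** Two uses of the mean value theorem, first along [u] for the increment of
    [f] along [v], then along [v] for ['D_u f]. The left-hand side is symmetric
    under exchanging [(u, s)] and [(v, t)], which is what makes mixed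
    derivatives agree. *)
Lemma second_difference V (f : V -> R^o) (x u v : V) (s t : R) : smooth f ->
  exists c1 c2 : R, [/\ 0 <= c1 <= 1, 0 <= c2 <= 1 &
    f (x + s *: u + t *: v) - f (x + s *: u) - f (x + t *: v) + f x =
    s * t * 'D_v ('D_u f) (x + (c1 * s) *: u + (c2 * t) *: v)].
Proof.
move=> sf.
have sh : smooth (fun y => f (y + t *: v) - f y : R^o).
  by apply: smoothB => //; exact: smooth_shift.
have [y|c1 c1P e1] := MVT_along x (s *: u) (h := fun y => f (y + t *: v) - f y : R^o).
  exact: smooth_differentiable.
have [y|c2 c2P e2] := MVT_along (x + (c1 * s) *: u) (t *: v) (h := 'D_u f).
  exact/smooth_differentiable/smooth_derive.
exists c1, c2; split=> //.
have -> : f (x + s *: u + t *: v) - f (x + s *: u) - f (x + t *: v) + f x =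
  f (x + s *: u + t *: v) - f (x + s *: u) - (f (x + t *: v) - f x).
  by rewrite opprB addrA -addrA [f x - _]addrC addrA.
rewrite e1 derive_scale_dir; last exact: smooth_differentiable.
rewrite -mulrA; congr (_ * _).
rewrite deriveB; last 2 first.
  exact/smooth_derivable/smooth_shift.
  exact: smooth_derivable.
rewrite derive_translate scalerA e2 derive_scale_dir ?scalerA//.
exact/smooth_differentiable/smooth_derive.
Qed.

(** Equality of mixed derivatives: by [second_difference], one of
    them takes at some point near to [x] the value that the other one takes at
    some other such point, and both are continuous. *)
Lemma derive_comm V (f : V -> R^o) (u v : V) :
  smooth f -> 'D_v ('D_u f) = 'D_u ('D_v f).
Proof.
move=> sf; apply/funext => x.
(* The points given by [second_difference] are near to [x] uniformly in the
   intermediate parameters [c1] and [c2]. *)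
have cont (p q : V) (e : R) : 0 < e -> exists2 r : R, 0 < r &
    forall s c1 c2 : R, 0 < s < r -> 0 <= c1 <= 1 -> 0 <= c2 <= 1 ->
    `|'D_q ('D_p f) x - 'D_q ('D_p f) (x + (c1 * s) *: p + (c2 * s) *: q)| < e.
  move=> e0.
  have /(_ x)/cvgrPdist_lt/(_ e e0)/nbhs_normP[r /= r0 rP] :=
    smooth_continuous (smooth_derive q (smooth_derive p sf)).
  have pq : 0 < `|p| + `|q| + 1 by rewrite ltr_wpDl// addr_ge0.
  exists (r / (`|p| + `|q| + 1)); first by rewrite divr_gt0.
  move=> s c1 c2 /andP[s0 sr] c1P c2P; apply: rP.
  rewrite /ball_/= -addrA opprD addrA subrr add0r normrN.
  apply: le_lt_trans (ler_normD _ _) _; rewrite !normrZ.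
  have aux (c : R) (y : V) : 0 <= c <= 1 -> `|c| * `|s| * `|y| <= s * `|y|.
    move=> /andP[c0 cl1]; rewrite ler_wpM2r// (ger0_norm c0) gtr0_norm//.
    by rewrite ler_piMl// ltW.
  apply: le_lt_trans (lerD (aux _ p c1P) (aux _ q c2P)) _.
  rewrite -mulrDr; apply: (@le_lt_trans _ _ (s * (`|p| + `|q| + 1))).
    by rewrite ler_pM2l// lerDl.
  by rewrite -ltr_pdivlMr.
apply/eqP; rewrite -subr_eq0 -normr_eq0 eq_le normr_ge0 andbT.
apply/ler_addgt0Pr => e e0; rewrite add0r.
have e20 : 0 < e / 2 by rewrite divr_gt0.
have [r1 r10 Huv] := cont u v _ e20.
have [r2 r20 Hvu] := cont v u _ e20.
pose s : R := Num.min r1 r2 / 2.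
have m0 : 0 < Num.min r1 r2 by rewrite lt_min r10.
have s0 : 0 < s by rewrite divr_gt0.
have sm : s < Num.min r1 r2 by rewrite ltr_pdivrMr// ltr_pMr// ltr1n.
have s1 : 0 < s < r1 by move: sm; rewrite s0 lt_min => /andP[].
have s2 : 0 < s < r2 by move: sm; rewrite s0 lt_min => /andP[].
have [c1 [c2 [c1P c2P E]]] := second_difference x u v s s sf.
have [c3 [c4 [c3P c4P E']]] := second_difference x v u s s sf.
have EE : 'D_v ('D_u f) (x + (c1 * s) *: u + (c2 * s) *: v) =
          'D_u ('D_v f) (x + (c3 * s) *: v + (c4 * s) *: u).
  have ss : s * s != 0 by rewrite mulf_neq0// gt_eqF.
  have uv : x + s *: v + s *: u = x + s *: u + s *: v by rewrite addrAC.
  rewrite uv in E'; apply: (mulfI ss); apply: (etrans (esym E)).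
  by apply: etrans E'; congr (_ + f x); rewrite [LHS]addrAC.
have := Huv s c1 c2 s1 c1P c2P; have := Hvu s c3 c4 s2 c3P c4P; rewrite -EE.
generalize ('D_v ('D_u f) x) ('D_u ('D_v f) x)
  ('D_v ('D_u f) (x + (c1 * s) *: u + (c2 * s) *: v)) => a b c bc ac.
rewrite (splitr e); apply: (le_trans (ler_distD c a b)); apply: lerD.
  exact: ltW.
by rewrite distrC ltW.
Qed.

End Calculus.

(** * Iterated directional derivatives *)

Section IteratedDerivatives.
Context {R : realType}.
Implicit Types V W : normedModType R.

Definition derives V (vs : seq V) (f : V -> R^o) : V -> R^o :=
  foldr (fun v h => 'D_v h) f vs.

Lemma smooth_derives V vs (f : V -> R^o) : smooth f -> smooth (derives vs f).
Proof. by move=> sf; elim: vs => //= v vs IHvs; exact: smooth_derive. Qed.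

Lemma derives_rcons V vs v (f : V -> R^o) :
  derives (rcons vs v) f = derives vs ('D_v f).
Proof. exact: foldr_rcons. Qed.

Lemma derives_move V vs v ws (f : V -> R^o) : smooth f ->
  derives (vs ++ v :: ws) f = derives (v :: vs ++ ws) f.
Proof.
move=> sf; elim: vs => //= u vs ->.
exact: (derive_comm v u (smooth_derives (vs ++ ws) sf)).
Qed.

Lemma perm_derives V (vs ws : seq V) (f : V -> R^o) : smooth f ->
  perm_eq vs ws -> derives vs f = derives ws f.
Proof.
move=> sf; elim: vs ws => [|v vs IHvs] ws.
  by rewrite perm_sym => /perm_nilP ->.
move=> pvw; have : v \in ws by rewrite -(perm_mem pvw) mem_head.
move=> vws; case/splitPr: vws pvw => w1 w2.
rewrite -[v :: w2]cat1s perm_sym perm_catCA/= perm_cons perm_sym => pv.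
by rewrite derives_move//= (IHvs _ pv).
Qed.

Lemma partialE d (alpha : 'I_d -> nat) (f : 'rV[R]_d -> R^o) :
  partial alpha f = derives
    [seq delta_mx 0 i | i <- flatten [seq nseq (alpha i) i | i <- enum 'I_d]] f.
Proof.
rewrite /partial; elim: (enum _) => //= i s ->.
rewrite map_cat /derives foldr_cat; move: (foldr _ _ _) => h.
by elim: (alpha i) => //= n ->.
Qed.

Lemma perm_multiplicities d (js : seq 'I_d) :
  perm_eq (flatten [seq nseq (count_mem i js) i | i <- enum 'I_d]) js.
Proof.
apply/permP => a; rewrite count_flatten sumnE -map_comp big_map.
under eq_bigr do rewrite /= count_nseq.
rewrite big_enum/=; elim: js => [|j js IHjs] /=.
  by rewrite big1// => i _; rewrite muln0.
under eq_bigr do rewrite mulnDr.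
rewrite big_split/= IHjs; congr addn.
rewrite (bigD1 j)//= eqxx muln1 big1 ?addn0// => i.
by rewrite eq_sym => /negPf ->; rewrite muln0.
Qed.

(** [partial] differentiates in a fixed order of the coordinates; since mixed
    derivatives commute, it captures every list of coordinate directions. *)
Lemma derives_partial d (js : seq 'I_d) (f : 'rV[R]_d -> R^o) : smooth f ->
  derives [seq delta_mx 0 j | j <- js] f = partial (fun i => count_mem i js) f.
Proof.
move=> sf; rewrite partialE; apply: perm_derives => //; apply: perm_map.
by rewrite perm_sym perm_multiplicities.
Qed.

Lemma derivesB V (vs : seq V) (f g : V -> R^o) : smooth f -> smooth g ->
  derives vs (fun x => f x - g x) = fun x => derives vs f x - derives vs g x.
Proof.
move=> sf sg; elim: vs => //= v vs ->; apply/funext => x.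
by apply: deriveB; apply: smooth_derivable; exact: smooth_derives.
Qed.

Lemma derivesD V (vs : seq V) (f g : V -> R^o) : smooth f -> smooth g ->
  derives vs (fun x => f x + g x) = fun x => derives vs f x + derives vs g x.
Proof.
move=> sf sg; elim: vs => //= v vs ->; apply/funext => x.
by apply: deriveD; apply: smooth_derivable; exact: smooth_derives.
Qed.

Lemma derives_translate V (vs : seq V) (f : V -> R^o) a :
  derives vs (fun x => f (x + a)) = fun x => derives vs f (x + a).
Proof.
by elim: vs => //= v vs ->; apply/funext => x; exact: derive_translate.
Qed.

Lemma derive_slice V W (F : R^o * V -> W) (th : R^o) (v x : V) :
  'D_v (fun y => F (th, y)) x = 'D_(0, v) F (th, x).
Proof.
apply: (proj1 (derive_along_eq _)) => t.
by congr F; congr pair; rewrite /= scaler0 add0r.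
Qed.

Lemma smooth_slice V W (F : R^o * V -> W) (th : R^o) :
  smooth F -> smooth (fun x => F (th, x)).
Proof.
have cpair (x : V) : differentiable (fun y : V => (th, y)) x.
  by apply: differentiable_pair => //; exact: differentiable_cst.
move=> sF k; elim: k F sF => [|k IHk] F sF.
  move=> x; apply: (@continuous_comp _ _ _ (fun y : V => (th, y)) F).
    exact: differentiable_continuous.
  exact: (smooth_continuous sF).
rewrite CkSE; split=> [x|v].
  apply: (@differentiable_comp _ _ _ _ (fun y : V => (th, y)) F) => //.
  exact: smooth_differentiable.
have -> : 'D_v (fun y => F (th, y)) = fun y => 'D_(0, v) F (th, y).
  by apply/funext => x; exact: derive_slice.
exact: (IHk _ (smooth_derive _ sF)).
Qed.

(** Derivatives in [x] at a frozen parameter are derivatives of the function of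
    both variables; bounds on the latter over compact sets of [R^o * V] are
    therefore uniform in the parameter. *)
Lemma derives_slice V (vs : seq V) (F : R^o * V -> R^o) (th : R^o) :
  derives vs (fun y => F (th, y)) =
  fun x => derives [seq (0, v) | v <- vs] F (th, x).
Proof.
by elim: vs => //= v vs ->; apply/funext => x; exact: derive_slice.
Qed.

End IteratedDerivatives.

(** * Bounds on nets and on their derivatives *)

Section Rates.
Context {R : realType}.
Implicit Types (V : normedModType R) (S : set (R -> R)).

(** The sets of admissible bounds: this abstraction treats moderate and
    negligible nets at the same time. *)
Definition rate_class S := [/\ S (fun=> 0),
  (forall r s, S r -> S s -> S (fun e => r e + s e)) &
  (forall c r, S r -> S (fun e => c * r e))].

Definition bounded_by V S (F : R -> V -> R^o) := forall K : set V, compact K ->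
  exists2 r : R -> R, S r & \forall e \near 0^'+, forall x, K x -> `|F e x| <= r e.

(** This follows the recursion of [Ck], so that the stability of [bounded_to]
    under products and compositions is proved like that of [Ck]. *)
Fixpoint bounded_to V S k (F : R -> V -> R^o) : Prop :=
  bounded_by S F /\
  if k is k'.+1 then forall v, bounded_to S k' (fun e => 'D_v (F e)) else True.

Definition smooth_net V (F : R -> V -> R^o) :=
  forall e : R, 0 < e < 1 -> smooth (F e).

Definition eq_net V (F G : R -> V -> R^o) := forall e : R, 0 < e < 1 -> F e = G e.

Lemma near01 : \forall e \near (0 : R)^'+, 0 < e < 1.
Proof.
near=> e; apply/andP; split; near: e; first exact: nbhs_right_gt.
exact: nbhs_right_lt.
Unshelve. all: by end_near. Qed.

Lemma bounded_by_ext V S (F G : R -> V -> R^o) :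
  eq_net F G -> bounded_by S F -> bounded_by S G.
Proof.
move=> FG bF K /bF[r Sr Fr]; exists r => //.
near=> e; rewrite -FG; last by near: e; exact: near01.
by near: e; exact: Fr.
Unshelve. all: by end_near. Qed.

Lemma bounded_to_ext V S k (F G : R -> V -> R^o) :
  eq_net F G -> bounded_to S k F -> bounded_to S k G.
Proof.
elim: k F G => [|k IHk] F G FG /= [bF DF]; split; try exact: bounded_by_ext bF.
  by [].
by move=> v; apply: IHk (DF v) => e e01; rewrite FG.
Qed.

Lemma bounded_to_bounded_by V S k (F : R -> V -> R^o) :
  bounded_to S k F -> bounded_by S F.
Proof. by case: k => [|k] []. Qed.

Lemma bounded_toW V S k (F : R -> V -> R^o) :
  bounded_to S k.+1 F -> bounded_to S k F.
Proof.
by elim: k F => [|k IHk] F /= [bF DF]; split=> // v; apply: IHk; exact: DF.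
Qed.

Lemma bounded_by_derives V S (F : R -> V -> R^o) vs :
  (forall k, bounded_to S k F) -> bounded_by S (fun e => derives vs (F e)).
Proof.
elim/last_ind: vs F => [|vs v IHvs] F bF; first exact: (bF 0%N).1.
apply: (@bounded_by_ext _ _ (fun e => derives vs ('D_v (F e)))).
  by move=> e _; rewrite derives_rcons.
by apply: IHvs => k; exact: (bF k.+1).2.
Qed.

Lemma continuous_compact_bounded (W : topologicalType) (c : W -> R^o) (K : set W) :
  continuous c -> compact K -> exists M : R, forall x, K x -> `|c x| <= M.
Proof.
move=> cc cK.
have /compact_bounded[M [_ MP]] : compact (c @` K).
  by apply: continuous_compact => //; exact: continuous_subspaceT.
exists (M + 1) => x Kx; apply: (MP (M + 1)); first by rewrite ltrDl.
by exists x.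
Qed.

Section Closure.
Variables (V : normedModType R) (S : set (R -> R)).
Hypothesis rS : rate_class S.
Implicit Types F G : R -> V -> R^o.

Lemma bounded_by_add F G : bounded_by S F -> bounded_by S G ->
  bounded_by S (fun e x => F e x + G e x).
Proof.
case: rS => _ SD _ bF bG K cK.
have [r Sr Fr] := bF K cK; have [s Ss Gs] := bG K cK.
exists (fun e => r e + s e); first exact: SD.
near=> e => x Kx; apply: le_trans (ler_normD _ _) _; apply: lerD.
  by move: x Kx; near: e.
by move: x Kx; near: e.
Unshelve. all: by end_near. Qed.

Lemma bounded_by_mul F (c : V -> R^o) : continuous c -> bounded_by S F ->
  bounded_by S (fun e x => F e x * c x).
Proof.
case: rS => _ _ SM cc bF K cK; have [r Sr Fr] := bF K cK.
have [M MP] := continuous_compact_bounded cc cK.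
exists (fun e => M * r e); first exact: SM.
near=> e => x Kx; rewrite normrM mulrC; apply: ler_pM => //; first exact: MP.
by move: x Kx; near: e.
Unshelve. all: by end_near. Qed.

Lemma bounded_to_add k F G : smooth_net F -> smooth_net G ->
  bounded_to S k F -> bounded_to S k G ->
  bounded_to S k (fun e x => F e x + G e x).
Proof.
elim: k F G => [|k IHk] F G sF sG [bF DF] [bG DG].
  by split=> //; exact: bounded_by_add.
split=> [|v]; first exact: bounded_by_add.
apply: (@bounded_to_ext _ _ _ (fun e x => 'D_v (F e) x + 'D_v (G e) x)).
  move=> e e01; apply/funext => x; rewrite deriveD//.
    exact/smooth_derivable/sF.
  exact/smooth_derivable/sG.
apply: IHk; [| |exact: DF|exact: DG].
  by move=> e e01; exact/smooth_derive/sF.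
by move=> e e01; exact/smooth_derive/sG.
Qed.

(** By the Leibniz rule each derivative falls on [F e] or on [c]; as [c] does
    not depend on e, its derivatives only contribute constants. *)
Lemma bounded_to_mul k F (c : V -> R^o) : smooth_net F -> smooth c ->
  bounded_to S k F -> bounded_to S k (fun e x => F e x * c x).
Proof.
elim: k F c => [|k IHk] F c sF sc bF.
  split=> //; apply: bounded_by_mul; first exact: smooth_continuous.
  exact: bounded_to_bounded_by bF.
split=> [|v].
  apply: bounded_by_mul; first exact: smooth_continuous.
  exact: bounded_to_bounded_by bF.
apply: (@bounded_to_ext _ _ _
    (fun e x => F e x * 'D_v c x + 'D_v (F e) x * c x)).
  move=> e e01; apply/funext => x; rewrite deriveM.
  - by rewrite /GRing.scale/= [c x * _]mulrC.
  - exact/smooth_derivable/sF.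
  - exact: smooth_derivable.
have sDF : smooth_net (fun e => 'D_v (F e)).
  by move=> e e01; exact/smooth_derive/sF.
have sDc := smooth_derive v sc.
apply: bounded_to_add.
- by move=> e e01; apply: smoothM => //; exact: sF.
- by move=> e e01; apply: smoothM => //; exact: sDF.
- by apply: IHk => //; exact: bounded_toW.
- by apply: IHk => //; exact: bF.2.
Qed.

Lemma bounded_to_cst0 k : bounded_to S k (fun (_ : R) (_ : V) => 0 : R^o).
Proof.
have [S0 _ _] := rS.
have b0 : bounded_by S (fun (_ : R) (_ : V) => 0 : R^o).
  by move=> K _; exists (fun=> 0) => //; near=> e => x _; rewrite normr0.
elim: k => [|k IHk]; split=> // v.
apply: bounded_to_ext IHk => e _; apply/funext => x.
by rewrite derive_cst.
Unshelve. all: by end_near. Qed.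

Lemma bounded_to_sum k n (F : 'I_n -> R -> V -> R^o) :
  (forall i, smooth_net (F i)) -> (forall i, bounded_to S k (F i)) ->
  bounded_to S k (fun e x => \sum_i F i e x).
Proof.
elim: n F => [|n IHn] F sF bF.
  apply: bounded_to_ext (bounded_to_cst0 k) => e _; apply/funext => x.
  by rewrite big_ord0.
apply: (@bounded_to_ext _ _ _
    (fun e x => F ord0 e x + \sum_i F (lift ord0 i) e x)).
  by move=> e _; apply/funext => x; rewrite big_ord_recl.
apply: bounded_to_add => //; last exact: IHn.
by move=> e e01 m; apply: Ck_sum => i; exact: sF.
Qed.

End Closure.

(** By the chain rule, a derivative of [w e \o G] is a sum of derivatives of
    [w e] along [G] multiplied by derivatives of [G] that do not depend on e;
    and [G] maps compact sets to compact sets. *)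
Lemma bounded_to_comp V n S (w : R -> 'rV[R]_n -> R^o) (G : V -> 'rV[R]_n) k :
  rate_class S -> smooth_net w -> smooth G ->
  (forall js, bounded_by S (fun e => derives [seq delta_mx 0 j | j <- js] (w e))) ->
  bounded_to S k (fun e => w e \o G).
Proof.
move=> rS sw sG; elim: k w sw => [|k IHk] w sw bw; rewrite /=.
  split=> // K cK.
  have cGK : compact (G @` K).
    by apply: continuous_compact => //; exact/continuous_subspaceT/smooth_continuous.
  have [r Sr wr] := bw [::] _ cGK; exists r => //.
  by apply: filterS wr => e wr x Kx; apply: wr; exists x.
split=> [|v].
  exact: bounded_to_bounded_by (IHk w sw bw).
apply: (@bounded_to_ext _ _ _
    (fun e x => \sum_j ('D_(delta_mx 0 j) (w e) \o G) x * 'D_v G x 0 j : R^o)).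
  move=> e e01; apply/funext => x; rewrite derive_row_comp//.
    exact: smooth_differentiable.
  exact/smooth_differentiable/sw.
have sDw j : smooth_net (fun e => 'D_(delta_mx 0 j) (w e)).
  by move=> e e01; exact/smooth_derive/sw.
have sDG j : smooth (fun x => 'D_v G x 0 j : R^o).
  by move=> m; exact/Ck_coord/smooth_derive.
apply: bounded_to_sum => // j.
  move=> e e01; apply: smoothM; last exact: sDG.
  exact: (smooth_comp (sDw j e e01) sG).
apply: bounded_to_mul => //.
  by move=> e e01; exact: (smooth_comp (sDw j e e01) sG).
apply: (IHk (fun e => 'D_(delta_mx 0 j) (w e))) => // js.
apply: bounded_by_ext (bw (rcons js j)) => e e01.
by rewrite map_rcons derives_rcons.
Qed.

(** A net is negligible when it is tame for the rates O(e^b), for every b, and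
    moderate when it is tame for the union of these classes. *)
Definition tame V S (F : R -> V -> R^o) :=
  smooth_net F /\ forall vs, bounded_by S (fun e => derives vs (F e)).

(** Only the coordinate derivatives of [w] are assumed to be bounded; with
    [G := id] this yields bounds in all directions. *)
Lemma tame_comp V n S (w : R -> 'rV[R]_n -> R^o) (G : V -> 'rV[R]_n) :
  rate_class S -> smooth G -> smooth_net w ->
  (forall js, bounded_by S (fun e => derives [seq delta_mx 0 j | j <- js] (w e))) ->
  tame S (fun e => w e \o G).
Proof.
move=> rS sG sw bw; split=> [e e01|vs].
  by apply: smooth_comp => //; exact: sw.
by apply: bounded_by_derives => k; exact: bounded_to_comp.
Qed.

End Rates.

(** * Moderate and negligible rates, and generalized parameters *)

Section PowerRates.
Context {R : realType}.
Implicit Types (V : normedModType R) (S : set (R -> R)).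

Lemma bigO_rateP (b : R) (h : R -> R) : bigO_rate b h <->
  exists C : R, \forall e \near 0^'+, `|h e| <= C * e `^ b.
Proof.
have nbE (e : R) : `|e `^ b| = e `^ b by rewrite ger0_norm// powR_ge0.
split.
  move=> /eqO_exP[C _ hC]; exists C; apply: filterS hC => e.
  by rewrite [`|e `^ b : R^o|]nbE.
move=> [C hC]; apply/eqO_exP; exists (`|C| + 1); first by rewrite ltr_wpDl.
apply: filterS hC => e /le_trans; apply; rewrite [`|e `^ b : R^o|]nbE.
by rewrite ler_wpM2r ?powR_ge0// (le_trans (ler_norm C))// lerDl.
Qed.

Lemma le_bigO_rate b (h k : R -> R) : (\forall e \near 0^'+, `|h e| <= `|k e|) ->
  bigO_rate b k -> bigO_rate b h.
Proof.
move=> hk /bigO_rateP[C kC]; apply/bigO_rateP; exists C.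
near=> e; apply: (@le_trans _ _ `|k e|); first by near: e.
by near: e.
Unshelve. all: by end_near. Qed.

Lemma bigO_rateW (b c : R) (h : R -> R) : c <= b -> bigO_rate b h -> bigO_rate c h.
Proof.
move=> cb /bigO_rateP[C hC]; apply/bigO_rateP; exists `|C|.
near=> e; apply: (@le_trans _ _ (C * e `^ b)); first by near: e.
apply: (@le_trans _ _ (`|C| * e `^ b)).
  by rewrite ler_wpM2r ?powR_ge0// ler_norm.
rewrite ler_wpM2l//; apply: ger_powR => //.
suff /andP[-> /ltW ->] : 0 < e < 1 by [].
by near: e; exact: near01.
Unshelve. all: by end_near. Qed.

Lemma rate_class_bigO b : rate_class (bigO_rate b : set (R -> R)).
Proof.
split.
- apply/bigO_rateP; exists 0; near=> e; by rewrite normr0 mul0r.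
- move=> r s /bigO_rateP[C rC] /bigO_rateP[D sD]; apply/bigO_rateP.
  exists (C + D); near=> e; rewrite mulrDl.
  apply: le_trans (ler_normD _ _) _; apply: lerD; by near: e.
- move=> c r /bigO_rateP[C rC]; apply/bigO_rateP; exists (`|c| * C).
  by near=> e; rewrite normrM -mulrA ler_wpM2l//; near: e.
Unshelve. all: by end_near. Qed.

Definition moderate : set (R -> R) := [set r | exists b, bigO_rate b r].

Lemma rate_class_moderate : rate_class moderate.
Proof.
split.
- by exists 0; case: (rate_class_bigO 0).
- move=> r s [b rb] [c sc]; exists (Num.min b c).
  case: (rate_class_bigO (Num.min b c)) => _ D _; apply: D.
    by apply: bigO_rateW rb; rewrite ge_min lexx.
  by apply: bigO_rateW sc; rewrite ge_min lexx orbT.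
- by move=> c r [b rb]; exists b; case: (rate_class_bigO b) => _ _; exact.
Qed.

Lemma bigO_rateM b c (h k : R -> R) : bigO_rate b h -> bigO_rate c k ->
  bigO_rate (b + c) (fun e => h e * k e).
Proof.
move=> /bigO_rateP[C hC] /bigO_rateP[D kD]; apply/bigO_rateP.
exists (C * D); near=> e; rewrite normrM powRD; last first.
  apply/implyP => _; rewrite gt_eqF//; near: e; exact: nbhs_right_gt.
by rewrite mulrACA; apply: ler_pM => //; near: e.
Unshelve. all: by end_near. Qed.

Lemma bounded_rnet_itv (t : R -> R) : bounded_rnet t ->
  exists M : R, \forall e \near 0^'+, (t e \in `[- M, M]).
Proof.
by move=> [M tM]; exists M; apply: filterS tM => e; rewrite in_itv/= -ler_norml.
Qed.

(** A bounded parameter stays in a compact interval, on whose product with [K]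
    the bounds for [F] hold uniformly. *)
Lemma tame_slice V S (F : R -> R^o * V -> R^o) (t : R -> R) :
  bounded_rnet t -> tame S F -> tame S (fun e x => F e (t e, x)).
Proof.
move=> /bounded_rnet_itv[M tM] [sF bF]; split=> [e e01|vs K cK].
  exact/smooth_slice/sF.
have cMK : compact ((`[- M, M]%classic : set R^o) `*` K).
  by apply: compact_setX => //; exact: segment_compact.
have [r Sr Fr] := bF [seq (0, v) | v <- vs] _ cMK.
exists r => //; near=> e => x Kx; rewrite derives_slice.
have te : t e \in `[- M, M] by near: e.
have : forall p, ((`[- M, M]%classic : set R^o) `*` K) p ->
    `|derives [seq (0, v) | v <- vs] (F e) p| <= r e by near: e.
by apply; split.
Unshelve. all: by end_near. Qed.

Lemma segment_itv (a b s N : R) : 0 <= s <= 1 ->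
  - N <= a <= N -> - N <= b <= N -> - N <= a + s * (b - a) <= N.
Proof.
move=> /andP[s0 s1] /andP[a1 a2] /andP[b1 b2].
by apply/andP; split; nra.
Qed.

(** The mean value theorem in the parameter bounds every derivative of the
    difference by [`|t e - t' e|], which is negligible, times a derivative of
    [F e], which is moderate. *)
Lemma tame_slice_sub V (F : R -> R^o * V -> R^o) (t t' : R -> R) b :
  bounded_rnet t -> bounded_rnet t' -> negligible_rnet (fun e => t e - t' e) ->
  tame moderate F ->
  tame (bigO_rate b) (fun e x => F e (t e, x) - F e (t' e, x)).
Proof.
move=> /bounded_rnet_itv[M tM] /bounded_rnet_itv[M' tM'] tt' [sF bF].
split=> [e e01|vs K cK].
  by apply: smoothB; exact/smooth_slice/sF.
pose N := Num.max M M'.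
have cNK : compact ((`[- N, N]%classic : set R^o) `*` K).
  by apply: compact_setX => //; exact: segment_compact.
pose vs' := [seq (0 : R^o, v) | v <- vs].
(* One more derivative than for [tame_slice], in the direction of the
   parameter. *)
have [r [c rc] Fr] := bF ((1, 0) :: vs') _ cNK.
exists (fun e => `|t e - t' e| * r e).
  (* The rate b - c of [t e - t' e] makes up for the rate c of [r]. *)
  by rewrite -(subrK c b); exact: bigO_rateM.
near=> e => x Kx.
have e01 : 0 < e < 1 by near: e; exact: near01.
rewrite derivesB; [|exact/smooth_slice/sF|exact/smooth_slice/sF].
rewrite !derives_slice -/vs'.
have te : t e \in `[- M, M] by near: e.
have te' : t' e \in `[- M', M'] by near: e.
have Fe : forall p, ((`[- N, N]%classic : set R^o) `*` K) p ->
    `|derives ((1, 0) :: vs') (F e) p| <= r e by near: e.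
have sH := smooth_derives vs' (sF e e01).
have [y|s s01 E] := MVT_along (t' e : R^o, x)
  ((t e - t' e) *: (1 : R^o, 0 : V)) (h := derives vs' (F e)).
  exact: smooth_differentiable.
have tx : (t' e : R^o, x) + (t e - t' e) *: (1 : R^o, 0 : V) = (t e, x).
  congr pair; last by rewrite /= scaler0 addr0.
  by rewrite /= /GRing.scale/= mulr1 addrC subrK.
rewrite tx in E; rewrite E derive_scale_dir; last exact: smooth_differentiable.
rewrite normrM ler_wpM2l//; apply: Fe.
split=> /=; last by rewrite scaler0 scaler0 addr0.
rewrite /GRing.scale/= mulr1 in_itv/=.
have NM : M <= N by rewrite le_max lexx.
have NM' : M' <= N by rewrite le_max lexx orbT.
move: te te'; rewrite !in_itv/= => /andP[t1 t2] /andP[t1' t2'].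
apply: segment_itv => //; apply/andP; split.
- by apply: le_trans t1'; rewrite lerN2.
- exact: le_trans NM'.
- by apply: le_trans t1; rewrite lerN2.
- exact: le_trans NM.
Unshelve. all: by end_near. Qed.

Lemma baire_closed_cover (A : nat -> set R^o) :
  (forall n, closed (A n)) -> (forall x, exists n, A n x) ->
  exists n x, exists2 r : R, 0 < r & ball (x : R^o) r `<=` A n.
Proof.
move=> clA covA; apply: contrapT => noball.
have oA n : open (~` A n) /\ dense (~` A n).
  split; first exact: closed_openC.
  move=> O [x Ox] oO; apply: contrapT => OA; apply: noball.
  have /nbhs_ballP[r r0 rO] : nbhs x O by exact: open_nbhs_nbhs.
  exists n, x, r => // y /rO Oy; apply: contrapT => nAy.
  by apply: OA; exists y.
have [|x [_ xA]] := Baire oA _ openT; first by exists 0.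
by have [n Anx] := covA x; exact: (xA n Logic.I).
Qed.

End PowerRates.

(** * Uniformity of the invariance in the parameter *)

(** A Baire category argument: the parameters at which [P e] holds for all e
    below 1/(n+1) form a closed set, and these sets cover the line, so that
    one of them contains a ball. *)
Lemma baire_near {R : realType} (P : R -> set R^o) :
  (forall e : R, 0 < e < 1 -> closed (P e)) ->
  (forall th, \forall e \near 0^'+, P e th) ->
  exists (th : R^o) (r : R), 0 < r /\ \forall e \near 0^'+, ball th r `<=` P e.
Proof.
move=> clP nearP.
pose A n := \bigcap_(e in [set e : R | 0 < e < 1 /\ e < n.+1%:R^-1]) P e.
have clA n : closed (A n) by apply: closed_bigI => e [e01 _]; exact: clP.
have covA th : exists n, A n th.
  have [r /= r0 rP] := nearP th.
  have [n] := @ltr_add_invr R 0 r r0; rewrite add0r => nr; exists n => e /= [].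
  move=> /andP[e0 _] en; apply: rP => //=.
  by rewrite sub0r normrN gtr0_norm// (lt_trans en).
have [n [th [r r0 rA]]] := baire_closed_cover clA covA.
exists th, r; split=> //; near=> e => y /rA; apply; split.
  by near: e; exact: near01.
by near: e; apply: nbhs_right_lt; rewrite invr_gt0.
Unshelve. all: by end_near. Qed.

(** Giving up one power of e removes a constant; in this way a bound whose constant
    depends on a point turns into a bound without constants, to which
    compactness arguments apply. *)
Lemma powR_absorb {R : realType} (C b : R) :
  \forall e \near 0^'+, C * e `^ (b + 1) <= e `^ b.
Proof.
near=> e; have e0 : 0 < e by near: e; exact: nbhs_right_gt.
have -> : e `^ (b + 1) = e `^ b * e.
  by rewrite powRD ?powRr1 ?ltW//; apply/implyP => _; rewrite gt_eqF.
rewrite mulrCA -[leRHS]mulr1 ler_wpM2l ?powR_ge0//.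
apply: (@le_trans _ _ ((`|C| + 1) * e)).
  by rewrite ler_pM2r// (le_trans (ler_norm C))// lerDl.
rewrite -ler_pdivlMl ?mulr1; last by rewrite ltr_wpDl.
by near: e; apply: nbhs_right_le; rewrite invr_gt0 ltr_wpDl.
Unshelve. all: by end_near. Qed.

Lemma four_point_bound {R : realType} (p q q0 o a b c : R) :
  `|p - q| <= a -> `|q0 - q| <= b -> `|q0 - o| <= c -> `|p - o| <= a + (c + b).
Proof.
move=> pq q0q q0o; rewrite -(subrKA q) -[q - o](subrKA q0) [q - q0 + _]addrC.
apply: le_trans (ler_normD _ _) _; apply: lerD => //.
by apply: le_trans (ler_normD _ _) _; apply: lerD => //; rewrite distrC.
Qed.

Section Invariance.
Context {R : realType} {d : nat} (g : R -> 'rV[R]_d -> 'rV[R]_d).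
Hypothesis gD : forall th1 th2 : R, g (th1 + th2) = g th1 \o g th2.
Hypothesis g0 : g 0 = id.
Hypothesis g_smooth : smooth (fun p : R^o * 'rV[R]_d => g p.1 p.2).
Local Notation E := (R^o * 'rV[R]_d)%type.
Local Notation act := (fun p : E => g p.1 p.2).

Lemma tame_along_flow (z : R -> 'rV[R]_d -> R^o) b : tame (bigO_rate b) z ->
  tame (bigO_rate b) (fun e => z e \o act).
Proof.
move=> [sz bz]; apply: tame_comp => //.
exact: rate_class_bigO.
Qed.

Variable w : R -> 'rV[R]_d -> R^o.
Hypothesis sw : smooth_net w.
Hypothesis w_invariant : forall (r b : R),
  tame (bigO_rate b) (fun e x => w e (g r x) - w e x).

Let F e : E -> R^o := w e \o act.

Let sF : smooth_net F.
Proof. by move=> e e01; apply: smooth_comp => //; exact: sw. Qed.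

(** The translation of the parameter by [r] replaces [F e] by
    [w e \o g r \o act], so that the difference is the negligible net
    [w e \o g r - w e] composed with the flow. Hence it is small uniformly on
    compact sets of parameters, and not only at each parameter. *)
Lemma flow_translate_negligible (r b : R) (vs : seq E) (L : set E) : compact L ->
  exists C : R, \forall e \near 0^'+, forall p, L p ->
    `|derives vs (F e) (p + (r : R^o, 0)) - derives vs (F e) p| <= C * e `^ b.
Proof.
move=> cL; have [_ /(_ vs _ cL)[s /bigO_rateP[C sC] bs]] :=
  tame_along_flow (w_invariant r b).
exists C; near=> e => p Lp.
have e01 : 0 < e < 1 by near: e; exact: near01.
have se : `|s e| <= C * e `^ b by near: e.
apply: le_trans se; apply: le_trans (ler_norm _).
have : forall p, L p -> `|derives vs
    ((fun x => w e (g r x) - w e x) \o act) p| <= s e by near: e.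
move=> /(_ _ Lp).
have -> : (fun x => w e (g r x) - w e x) \o act =
    fun p => F e (p + (r : R^o, 0)) - F e p.
  apply/funext => q; rewrite /F /= addr0; congr (w e _ - _).
  by rewrite [q.1 + r]addrC gD.
rewrite derivesB ?derives_translate//; last exact: sF.
by apply: smooth_shift; exact: sF.
Unshelve. all: by end_near. Qed.

(** The passage from constant parameters to bounded nets of parameters. Let
    D e th be the deviation of [w e \o g th] from [w e], after the derivatives
    [vs] have been applied.
    Baire's theorem makes D e small uniformly in a ball around some th0. The
    parameter differences D e (s + th0) - D e s and D e (s + th1) - D e s are
    both small uniformly in s by [flow_translate_negligible], so D e is small
    uniformly in a ball of the same radius around every th1, and therefore on
    the compact interval in which the net of parameters lies. *)
Lemma uniform_invariance (t : R -> R) (b : R) : bounded_rnet t ->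
  tame (bigO_rate b) (fun e x => w e (g (t e) x) - w e x).
Proof.
move=> /bounded_rnet_itv[M tM]; split=> [e e01|vs K cK].
  apply: smoothB; last exact: sw.
  exact: (smooth_slice (t e) (sF e01)).
pose vs' := [seq (0 : R^o, v) | v <- vs].
pose D e (th : R) x := derives vs' (F e) (th : R^o, x) - derives vs' (F e) (0, x).
have DE e th : 0 < e < 1 ->
    derives vs (fun x => w e (g th x) - w e x) = D e th.
  move=> e01.
  have -> : (fun x => w e (g th x) - w e x) =
      fun x => F e (th : R^o, x) - F e (0 : R^o, x).
    by apply/funext => x; rewrite /F/= g0.
  rewrite derivesB ?derives_slice//; exact: (smooth_slice _ (sF e01)).
(* The exponent exceeds b by one because the constants that appear below depend
   on the parameter and have to be absorbed. *)
pose P e := [set th : R^o | forall x, K x -> `|D e th x| <= e `^ (b + 1)].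
have clP (e : R) : 0 < e < 1 -> closed (P e).
  move=> e01.
  have -> : P e = \bigcap_(x in K)
      ((fun th : R^o => `|D e th x|) @^-1` [set y : R | y <= e `^ (b + 1)]).
    by apply/seteqP; split.
  apply: closed_bigI => x _; apply: preimage_closed; last exact: closed_le.
  move=> th _; apply: (@continuous_comp _ _ _ (fun th : R^o => D e th x)
    (fun y : R^o => `|y|)); last exact: norm_continuous.
  apply: cvgB; last exact: cvg_cst.
  apply: (@continuous_comp _ _ _ (fun th : R^o => (th, x)) (derives vs' (F e))).
    apply/differentiable_continuous/differentiable_pair => //.
  exact/smooth_continuous/smooth_derives/sF.
have nearP th : \forall e \near 0^'+, P e th.
  have [_ /(_ vs _ cK)[s /bigO_rateP[C sC] bs]] := w_invariant th (b + 1 + 1).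
  near=> e => x Kx.
  have e0 : 0 < e by near: e; exact: nbhs_right_gt.
  have e01 : 0 < e < 1 by near: e; exact: near01.
  have se : `|s e| <= C * e `^ (b + 1 + 1) by near: e.
  have : forall x, K x ->
      `|derives vs (fun x => w e (g th x) - w e x) x| <= s e by near: e.
  move=> /(_ _ Kx); rewrite DE// => /le_trans; apply.
  apply: le_trans (ler_norm _) (le_trans se _).
  by near: e; exact: powR_absorb.
have [th0 [r [r0 rP]]] := baire_near clP nearP.
pose L : set E := (`[- r, r]%classic : set R^o) `*` K.
have cL : compact L by apply: compact_setX => //; exact: segment_compact.
have [C0 C0P] := flow_translate_negligible th0 (b + 1) vs' cL.
(* The ball around [th0] is carried to any other parameter [th1]. *)
have near0 th1 : exists C : R, \forall e \near 0^'+, forall s x,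
    `|s| < r -> K x -> `|D e (s + th1) x| <= C * e `^ (b + 1).
  have [C1 C1P] := flow_translate_negligible th1 (b + 1) vs' cL.
  exists (C1 + (1 + C0)); near=> e => s x sr Kx.
  have Lsx : L (s, x) by split=> //=; rewrite in_itv/= -ler_norml ltW.
  have H1 : forall p, L p -> `|derives vs' (F e) (p + (th1 : R^o, 0)) -
      derives vs' (F e) p| <= C1 * e `^ (b + 1) by near: e.
  have H0 : forall p, L p -> `|derives vs' (F e) (p + (th0 : R^o, 0)) -
      derives vs' (F e) p| <= C0 * e `^ (b + 1) by near: e.
  have H : ball th0 r `<=` P e by near: e.
  have /H/(_ x Kx) HP : ball th0 r (s + th0).
    by rewrite -ball_normE /ball_/= opprD addrCA subrr addr0 normrN.
  have trE (th : R) : (s : R^o, x) + (th : R^o, 0) = (s + th : R^o, x).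
    by congr pair; rewrite /= addr0.
  move: (H1 _ Lsx) (H0 _ Lsx) HP; rewrite !trE /D => h1 h0 hP.
  by rewrite !mulrDl mul1r; exact: (four_point_bound h1 h0 hP).
have unif : \forall e \near 0^'+, (`[- M, M]%classic : set R^o) `<=`
    (fun th => forall x, K x -> `|D e th x| <= e `^ b).
  have /compact_near_coveringP cM := @segment_compact R (- M) M.
  apply: cM => th1 _; have [C CP] := near0 th1.
  near=> th e => x Kx.
  have eP : forall s x, `|s| < r -> K x -> `|D e (s + th1) x| <= C * e `^ (b + 1).
    by near: e.
  have Ce : C * e `^ (b + 1) <= e `^ b by near: e; exact: powR_absorb.
  have thr : `|th - th1| < r.
    by rewrite distrC; near: th; exact: (@cvgr_dist_lt _ R^o _ _ _ id th1).
  by have := eP _ _ thr Kx; rewrite subrK => /le_trans; apply.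
exists (fun e => e `^ b).
  apply/bigO_rateP; exists 1; near=> e; by rewrite mul1r ger0_norm ?powR_ge0.
near=> e => x Kx; have e01 : 0 < e < 1 by near: e; exact: near01.
rewrite DE//; have te : t e \in `[- M, M] by near: e.
by have /(_ _ te _ Kx) : (`[- M, M]%classic : set R^o) `<=`
    (fun th => forall x, K x -> `|D e th x| <= e `^ b) by near: e.
Unshelve. all: by end_near. Qed.

End Invariance.

(** * Classes of nets in terms of their real and imaginary parts *)

Section TameGroup.
Context {R : realType}.
Implicit Types (V : normedModType R) (S : set (R -> R)).

Lemma tame0 V S : rate_class S -> tame S (fun (_ : R) (_ : V) => 0 : R^o).
Proof.
move=> rS; split=> [e _ k|vs]; first exact: Ck_cst.
by apply: bounded_by_derives => k; exact: bounded_to_cst0.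
Qed.

Lemma tame_add V S (F G : R -> V -> R^o) : rate_class S ->
  tame S F -> tame S G -> tame S (fun e x => F e x + G e x).
Proof.
move=> rS [sF bF] [sG bG]; split=> [e e01|vs].
  by apply: smoothD; [exact: sF|exact: sG].
apply: bounded_by_ext (bounded_by_add rS (bF vs) (bG vs)) => e e01.
by rewrite derivesD//; [exact: sF|exact: sG].
Qed.

Lemma tame_sub V S (F G : R -> V -> R^o) : rate_class S ->
  tame S F -> tame S G -> tame S (fun e x => F e x - G e x).
Proof.
move=> rS [sF bF] [sG bG]; split=> [e e01|vs].
  by apply: smoothB; [exact: sF|exact: sG].
have bNG : bounded_by S (fun e x => - derives vs (G e) x).
  move=> K cK; have [r Sr Gr] := bG vs K cK; exists r => //.
  by apply: filterS Gr => e Gr x Kx; rewrite normrN; exact: Gr.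
apply: bounded_by_ext (bounded_by_add rS (bF vs) bNG) => e e01.
by rewrite derivesB//; [exact: sF|exact: sG].
Qed.

End TameGroup.

Section Nets.
Context {R : realType} {d : nat}.
Implicit Types (u v : @net R d) (S : set (R -> R)).

Definition Re_net u : R -> 'rV[R]_d -> R^o := fun e x => complex.Re (u e x).
Definition Im_net u : R -> 'rV[R]_d -> R^o := fun e x => complex.Im (u e x).

Definition tame_net S u := tame S (Re_net u) /\ tame S (Im_net u).

(** Under this condition a seminorm belongs to [S] as soon as it is bounded by a
    member of [S]. *)
Definition solid S := forall h k : R -> R,
  (\forall e \near 0^'+, `|h e| <= `|k e|) -> S k -> S h.

Lemma normc_ge_Re (a b : R) : `|a| <= Normc.normc (Complex a b).
Proof. by rewrite /= -sqrtr_sqr ler_sqrt ?lerDl ?addr_ge0 ?sqr_ge0. Qed.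

Lemma normc_ge_Im (a b : R) : `|b| <= Normc.normc (Complex a b).
Proof. by rewrite /= -sqrtr_sqr ler_sqrt ?lerDr ?addr_ge0 ?sqr_ge0. Qed.

Lemma normc_le (a b : R) : Normc.normc (Complex a b) <= `|a| + `|b|.
Proof.
rewrite /= -[leRHS]ger0_norm ?addr_ge0// -sqrtr_sqr ler_sqrt ?sqr_ge0//.
rewrite sqrrD !real_normK ?num_real// addrAC lerDl.
by rewrite mulrn_wge0// mulr_ge0.
Qed.

(** A supremum bounds the values only if these are bounded, which here follows
    from compactness of [K]. *)
Lemma seminorm_ge K alpha u e x : smoothC (u e) -> compact K -> K x ->
  Normc.normc (partialC alpha (u e) x) <= seminorm K alpha (u e).
Proof.
move=> [sRe sIm] cK Kx; apply: ub_le_sup; last by exists x.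
have bnd (w : 'rV[R]_d -> R^o) : smooth w ->
    exists M : R, forall y, K y -> `|partial alpha w y| <= M.
  move=> sw; apply: continuous_compact_bounded => //.
  by rewrite partialE; exact/smooth_continuous/smooth_derives.
have [M MP] := bnd _ sRe; have [N NP] := bnd _ sIm.
exists (M + N) => _ [y Ky <-]; apply: le_trans (normc_le _ _) _.
by apply: lerD; [exact: MP|exact: NP].
Qed.

(** The seminorms only see the derivatives [partialC alpha] of [u], while tameness
    concerns all directions; [derives_partial] and [tame_comp] bridge this gap. *)
Lemma tame_netP S u : rate_class S -> solid S ->
  (EE u /\ forall K alpha, compact K -> S (fun e => seminorm K alpha (u e)))
  <-> tame_net S u.
Proof.
move=> rS solS; split=> [[Eu Su]|[[sRe bRe] [sIm bIm]]].
  have part (w : R -> 'rV[R]_d -> R^o) : smooth_net w ->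
    (forall alpha e x, `|partial alpha (w e) x| <=
       Normc.normc (partialC alpha (u e) x)) -> tame S w.
    move=> sw wu.
    have := @tame_comp R 'rV[R]_d d S w id rS _ sw; apply.
      exact: smooth_id.
    move=> js K cK; exists (fun e => seminorm K (fun i => count_mem i js) (u e)).
      exact: Su.
    near=> e => x Kx; have e01 : 0 < e < 1 by near: e; exact: near01.
    rewrite derives_partial; last exact: sw.
    by apply: le_trans (wu _ _ _) _; apply: seminorm_ge => //; exact: Eu.
  split; apply: part.
  - by move=> e e01; exact: (Eu e e01).1.
  - by move=> alpha e x; exact: normc_ge_Re.
  - by move=> e e01; exact: (Eu e e01).2.
  - by move=> alpha e x; exact: normc_ge_Im.
split=> [e e01|K alpha cK]; first by split; [exact: sRe|exact: sIm].
pose vs := [seq delta_mx 0 i : 'rV[R]_d |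
  i <- flatten [seq nseq (alpha i) i | i <- enum 'I_d]].
have [r Sr Rer] := bRe vs K cK; have [s Ss Ims] := bIm vs K cK.
have [_ SD _] := rS; apply: solS (SD _ _ Sr Ss).
near=> e.
have ubd : ubound [set Normc.normc (partialC alpha (u e) x) | x in K] (r e + s e).
  move=> _ [x Kx <-]; apply: le_trans (normc_le _ _) _; rewrite !partialE -/vs.
  apply: lerD.
    by move: x Kx; near: e; exact: Rer.
  by move: x Kx; near: e; exact: Ims.
have [K0|/set0P[x Kx]] := eqVneq K set0.
  by rewrite /seminorm K0 image_set0 sup0 normr0.
have n0 : 0 <= seminorm K alpha (u e).
  apply: le_trans (ub_le_sup _ _); last by exists x.
    by apply: le_trans (normc_ge_Re _ _).
  by exists (r e + s e).
rewrite ger0_norm// (le_trans _ (ler_norm _))//; apply: ge_sup => //.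
by exists (Normc.normc (partialC alpha (u e) x)), x.
Unshelve. all: by end_near. Qed.

Lemma solid_bigO (b : R) : solid (bigO_rate b : set (R -> R)).
Proof. by move=> h k; exact: le_bigO_rate. Qed.

Lemma solid_moderate : solid (@moderate R).
Proof. by move=> h k hk [b kb]; exists b; exact: le_bigO_rate kb. Qed.

Lemma EMP u : Defs.EM u <-> tame_net moderate u.
Proof.
rewrite -(tame_netP u rate_class_moderate solid_moderate).
by split=> -[].
Qed.

Lemma NNP u : NN u <-> forall b, tame_net (bigO_rate b) u.
Proof.
split=> [[Eu Nu] b|Nu].
  apply/(tame_netP u (rate_class_bigO b) (@solid_bigO b)).
  by split=> // K a cK; exact: Nu.
have H b := (tame_netP u (rate_class_bigO b) (@solid_bigO b)).2 (Nu b).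
by split=> [|K a cK b]; [exact: (H 0).1|exact: (H b).2].
Qed.

Lemma tame_net_add S u v : rate_class S -> tame_net S u -> tame_net S v ->
  tame_net S (fun e x => u e x + v e x).
Proof.
move=> rS [Ru Iu] [Rv Iv]; split.
  have := tame_add rS Ru Rv; congr tame; apply/funext => e; apply/funext => x.
  by rewrite /Re_net; case: (u e x) (v e x) => a b [].
have := tame_add rS Iu Iv; congr tame; apply/funext => e; apply/funext => x.
by rewrite /Im_net; case: (u e x) (v e x) => a b [].
Qed.

Lemma Re_netB u v : Re_net (fun e x => u e x - v e x) =
  fun e x => Re_net u e x - Re_net v e x.
Proof.
apply/funext => e; apply/funext => x.
by rewrite /Re_net; case: (u e x) (v e x) => a b [].
Qed.

Lemma Im_netB u v : Im_net (fun e x => u e x - v e x) =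
  fun e x => Im_net u e x - Im_net v e x.
Proof.
apply/funext => e; apply/funext => x.
by rewrite /Im_net; case: (u e x) (v e x) => a b [].
Qed.

Lemma tame_net_sub S u v : rate_class S -> tame_net S u -> tame_net S v ->
  tame_net S (fun e x => u e x - v e x).
Proof.
move=> rS [Ru Iu] [Rv Iv]; rewrite /tame_net Re_netB Im_netB.
by split; exact: tame_sub.
Qed.

Lemma NN_add u v : NN u -> NN v -> NN (fun e x => u e x + v e x).
Proof.
move=> /NNP Nu /NNP Nv; apply/NNP => b.
by apply: tame_net_add => //; exact: rate_class_bigO.
Qed.

Lemma NN_sub u v : NN u -> NN v -> NN (fun e x => u e x - v e x).
Proof.
move=> /NNP Nu /NNP Nv; apply/NNP => b.
by apply: tame_net_sub => //; exact: rate_class_bigO.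
Qed.

Lemma NN_EM u : NN u -> Defs.EM u.
Proof. by move=> [Eu Nu]; split=> // K alpha cK; exists 0; exact: Nu. Qed.

Lemma gclass_refl u : gclass u u.
Proof.
apply/NNP => b.
have E0 (w : R -> 'rV[R]_d -> R^o) :
    (fun e x => w e x - w e x : R^o) = fun _ _ => 0.
  by apply/funext => e; apply/funext => x; rewrite subrr.
rewrite /tame_net Re_netB Im_netB !E0.
by split; apply: tame0; exact: rate_class_bigO.
Qed.

Lemma eq_gclass u v : NN (fun e x => v e x - u e x) -> gclass u = gclass v.
Proof.
move=> uv; apply/seteqP; split=> z /= zN.
  have := NN_sub zN uv; congr NN; apply/funext => e; apply/funext => x.
  by rewrite opprB addrA subrK.
have := NN_add zN uv; congr NN; apply/funext => e; apply/funext => x.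
by rewrite addrA subrK.
Qed.

Lemma gclass_NN u v w : gclass w u -> gclass w v -> NN (fun e x => v e x - u e x).
Proof.
move=> wu wv; have := NN_sub wv wu; congr NN; apply/funext => e; apply/funext => x.
by rewrite opprB addrA subrK.
Qed.

Lemma gclass_EM u v : Defs.EM u -> gclass u v -> Defs.EM v.
Proof.
move=> /EMP Eu /NN_EM/EMP uv; apply/EMP.
have := tame_net_add rate_class_moderate uv Eu; congr tame_net.
by apply/funext => e; apply/funext => x; rewrite subrK.
Qed.

End Nets.

(** * Composition with the flow *)

Section GeneralizedParameters.
Context {R : realType}.
Implicit Types t s : R -> R.

Lemma rclass_refl t : rclass t t.
Proof.
move=> b; apply/bigO_rateP; exists 0; near=> e.
by rewrite subrr normr0 normr0 mul0r.
Unshelve. all: by end_near. Qed.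

Lemma rclass_bounded t s : bounded_rnet t -> rclass t s -> bounded_rnet s.
Proof.
move=> [M tM] /(_ 0)/bigO_rateP[C stC]; exists (C + M); near=> e.
rewrite -(subrK (t e) (s e)); apply: le_trans (ler_normD _ _) _; apply: lerD.
  have : `| `|s e - t e| | <= C * e `^ 0 by near: e.
  by rewrite normr_id powRr0 mulr1.
by near: e.
Unshelve. all: by end_near. Qed.

Lemma rclass_sub t s s' : rclass t s -> rclass t s' ->
  negligible_rnet (fun e => s e - s' e).
Proof.
move=> ts ts' b; case: (rate_class_bigO b) => _ D _.
apply: le_bigO_rate (D _ _ (ts b) (ts' b)); near=> e.
rewrite [leRHS]ger0_norm ?addr_ge0// normr_id [`|s' e - _|]distrC.
by apply: le_trans (ler_normD _ _); rewrite addrA subrK.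
Unshelve. all: by end_near. Qed.

End GeneralizedParameters.

Section Flow.
Context {R : realType} {d : nat} (g : R -> 'rV[R]_d -> 'rV[R]_d).
Hypothesis g_smooth : smooth (fun p : R^o * 'rV[R]_d => g p.1 p.2).
Implicit Types (u v : @net R d) (t s : R -> R).

Lemma tame_net_comp (S : set (R -> R)) u t : rate_class S -> bounded_rnet t ->
  tame_net S u -> tame_net S (comp_net g u t).
Proof.
move=> rS bt [[sR bR] [sI bI]]; split.
  apply: (tame_slice bt (F := fun e => Re_net u e \o (fun p => g p.1 p.2))).
  exact: tame_comp.
apply: (tame_slice bt (F := fun e => Im_net u e \o (fun p => g p.1 p.2))).
exact: tame_comp.
Qed.

Lemma EM_comp u t : bounded_rnet t -> Defs.EM u -> Defs.EM (comp_net g u t).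
Proof.
by move=> bt /EMP Eu; apply/EMP; apply: tame_net_comp => //; exact: rate_class_moderate.
Qed.

Lemma NN_comp u t : bounded_rnet t -> NN u -> NN (comp_net g u t).
Proof.
move=> bt /NNP Nu; apply/NNP => b.
by apply: tame_net_comp => //; exact: rate_class_bigO.
Qed.

Lemma NN_comp_sub u t s : bounded_rnet t -> bounded_rnet s ->
  negligible_rnet (fun e => t e - s e) -> Defs.EM u ->
  NN (fun e x => comp_net g u t e x - comp_net g u s e x).
Proof.
move=> bt bs ts /EMP[[sR bR] [sI bI]]; apply/NNP => b.
rewrite /tame_net Re_netB Im_netB; split.
  apply: (tame_slice_sub b bt bs ts (F := fun e => Re_net u e \o (fun p => g p.1 p.2))).
  by apply: tame_comp => //; exact: rate_class_moderate.
apply: (tame_slice_sub b bt bs ts (F := fun e => Im_net u e \o (fun p => g p.1 p.2))).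
by apply: tame_comp => //; exact: rate_class_moderate.
Qed.

(** Independence of the representatives: the change of [u] is a negligible net
    along the flow, and the change of [t] is covered by the mean value theorem. *)
Lemma gclass_comp u0 t0 u v t s : Defs.EM u0 -> bounded_rnet t0 ->
  gclass u0 u -> gclass u0 v -> rclass t0 t -> rclass t0 s ->
  gclass (comp_net g u t) = gclass (comp_net g v s).
Proof.
move=> Eu0 bt0 uu uv tt ts; apply: eq_gclass.
have bt := rclass_bounded bt0 tt; have bs := rclass_bounded bt0 ts.
have N1 := NN_comp bs (gclass_NN uu uv).
have N2 := NN_comp_sub bs bt (rclass_sub ts tt) (gclass_EM Eu0 uu).
have := NN_add N1 N2; congr NN; apply/funext => e; apply/funext => x.
by rewrite /comp_net addrA subrK.
Qed.

Lemma compG_gclass u0 t0 : Defs.EM u0 -> bounded_rnet t0 ->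
  compG g (gclass u0) (rclass t0) = gclass (comp_net g u0 t0).
Proof.
move=> Eu0 bt0; apply/seteqP; split=> [v [u [t [uu tt]]]|v uv].
  by rewrite (gclass_comp Eu0 bt0 uu (gclass_refl u0) tt (rclass_refl t0)).
by exists u0, t0; split=> //; [exact: gclass_refl|exact: rclass_refl].
Qed.

End Flow.
Theorem theorem2 (R : realType) (d : nat) (hd : (1 <= d)%N)
    (g : R -> 'rV[R]_d -> 'rV[R]_d)
    (g_bij : forall th : R, bijective (g th))
    (gD : forall th1 th2 : R, g (th1 + th2) = g th1 \o g th2)
    (g0 : g 0 = id)
    (gN : forall th : R, cancel (g th) (g (- th)) /\ cancel (g (- th)) (g th))
    (g_smooth : smooth (fun p : R^o * 'rV[R]_d => g p.1 p.2))
    (f : set (@net R d)) (hf : GG R d f) :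
  (forall th : set (R -> R), Rtilde_c R th ->
     comp_well_defined g f th /\ GG R d (compG g f th)) /\
  ((forall r : R, compG g f (cst_rclass r) = f) ->
   forall th : set (R -> R), Rtilde_c R th -> compG g f th = f).
Proof.
case: hf => u0 Eu0 <-; split=> [th [t0 bt0 <-]|inv th [t0 bt0 <-]].
  split; last first.
    by rewrite compG_gclass//; exists (comp_net g u0 t0) => //; exact: EM_comp.
  split=> [u t uu tt|u u' t t' uu uu' tt tt']; last exact: gclass_comp Eu0 bt0 _ _ _ _.
  by apply: EM_comp; [|exact: rclass_bounded tt|exact: gclass_EM uu].
rewrite compG_gclass//; apply/esym/eq_gclass.
have bcst r : bounded_rnet (fun _ : R => r).
  by exists `|r|; near=> e.
(* Only constant parameters are covered by the hypothesis; the step to [t0] is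
   [uniform_invariance] for the real and the imaginary part. *)
have invNN r : NN (fun e x => comp_net g u0 (fun=> r) e x - u0 e x).
  have := inv r; rewrite /cst_rclass compG_gclass// => invr.
  suff : gclass u0 (comp_net g u0 (fun=> r)) by [].
  by rewrite -invr; exact: gclass_refl.
have /EMP[[sR _] [sI _]] := Eu0; apply/NNP => b.
rewrite /tame_net Re_netB Im_netB; split.
  apply: (uniform_invariance gD g0 g_smooth sR _ b bt0) => r c.
  by have /NNP/(_ c)[+ _] := invNN r; rewrite Re_netB.
apply: (uniform_invariance gD g0 g_smooth sI _ b bt0) => r c.
by have /NNP/(_ c)[_] := invNN r; rewrite Im_netB.
Unshelve. all: by end_near. Qed.
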